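(* As formal power series in $x$, $$\sum_{n\ge 0}|\mathcal{M}_n(P_1,P_3)|\,x^n=\frac{1-6x+15x^2-19x^3+13x^4-5x^5}{(1-x)^5(1-2x)}.$$
   Context: A matching with $n$ arcs is a partition of $\{1,2,\ldots,2n\}$ into blocks of size 2, called arcs; an arc is written $[a,b]$ with $a<b$, where $a$ is its opener and $b$ its closer. For $n=0$ there is exactly one (empty) matching. A matching is Stoimenow if it contains no pair of arcs $[i,\ell],[i+1,k]$ with $i+1<k<\ell$ (Type 1) and no pair of arcs $[k,j+1],[\ell,j]$ with $k<\ell<j$ (Type 2). A matching $M$ contains a pattern (a matching) $P$ with $m$ arcs if some $m$ arcs of $M$ become $P$ after their $2m$ endpoints are relabelled $1,\ldots,2m$ in the order-preserving way; otherwise $M$ avoids $P$. $\mathcal{M}_n(Q_1,\ldots,Q_r)$ denotes the set of Stoimenow matchings with $n$ arcs avoiding every one of $Q_1,\ldots,Q_r$. The patterns are $P_1=\{[1,3],[2,7],[4,5],[6,8]\}$ and $P_3=\{[1,2],[3,5],[4,6],[7,8]\}$. *)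

(* Defs.v *)
From mathcomp Require Import all_boot all_order all_algebra.

Set Implicit Arguments.
Unset Strict Implicit.
Unset Printing Implicit Defensive.

Import GRing.Theory.

(* The point k of {1, ..., 2n} is represented by the ordinal k - 1 : 'I_n.*2. *)
Definition arcset (n : nat) := {set {set 'I_n.*2}}.

Section Matchings.
Variable n : nat.
Implicit Type M : arcset n.

Definition matching M := partition M [set: 'I_n.*2] && [forall B in M, #|B| == 2].

Definition arc M (a b : 'I_n.*2) := (a < b) && ([set a; b] \in M).

(* [i, l] and [i', k] with i' = i + 1 < k < l *)
Definition type1 M :=
  [exists i : 'I_n.*2, exists i' : 'I_n.*2, exists k : 'I_n.*2, exists l : 'I_n.*2,
    [&& val i' == i.+1, arc M i l, arc M i' k, i' < k & k < l]].

(* [k, j'] and [l, j] with j' = j + 1 and k < l < j *)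
Definition type2 M :=
  [exists j : 'I_n.*2, exists j' : 'I_n.*2, exists k : 'I_n.*2, exists l : 'I_n.*2,
    [&& val j' == j.+1, arc M k j', arc M l j, k < l & l < j]].

Definition stoimenow M := [&& matching M, ~~ type1 M & ~~ type2 M].

End Matchings.

(* S is a set of m arcs of M, and f is the increasing enumeration of the
   endpoints of S: f is the inverse of the order-preserving relabelling. *)
Definition contains (n m : nat) (M : arcset n) (P : arcset m) :=
  [exists S : arcset n, exists f : {ffun 'I_m.*2 -> 'I_n.*2},
    [&& S \subset M, #|S| == m,
        [forall a : 'I_m.*2, forall b : 'I_m.*2, (a < b) ==> (f a < f b)],
        f @: [set: 'I_m.*2] == cover S
      & [set f @: (B : {set 'I_m.*2}) | B in P] == S]].

Definition pattern := {m : nat & arcset m}.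

Definition avoids n (M : arcset n) (Q : pattern) := ~~ contains M (tagged Q).

Definition stoimenow_avoiding n (Qs : seq pattern) : {set arcset n} :=
  [set M | stoimenow M && all (avoids M) Qs].

(* The arc set on {1, ..., 2m} given by m pairs (opener, closer), numbered
   from 1. *)
Definition arcs_of (s : seq (nat * nat)) : arcset (size s) :=
  [set:: [seq [set i : 'I_(size s).*2 | (i.+1 == p.1) || (i.+1 == p.2)] | p <- s]].

Definition pattern_of (s : seq (nat * nat)) : pattern := Tagged arcset (arcs_of s).

Definition P1 : pattern := pattern_of [:: (1, 3); (2, 7); (4, 5); (6, 8)].
Definition P3 : pattern := pattern_of [:: (1, 2); (3, 5); (4, 6); (7, 8)].

Lemma arcs_of_matching (s : seq (nat * nat)) :
  perm_eq (flatten [seq [:: p.1; p.2] | p <- s]) (iota 1 (size s).*2) ->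
  matching (arcs_of s).
Proof.
move=> s_perm; set A := arcs_of s.
have covA : cover A = setT.
  apply/setP=> i; rewrite inE; apply/bigcupP.
  have: i.+1 \in flatten [seq [:: p.1; p.2] | p <- s].
    by rewrite (perm_mem s_perm) mem_iota /= add1n ltnS ltn_ord.
  case/flatten_mapP=> p ps; rewrite !inE => ip.
  by eexists; [rewrite inE; apply: map_f ps | rewrite inE].
have A_le2 B : B \in A -> #|B| <= 2.
  rewrite inE => /mapP[p _ ->].
  have inj : injective (fun i : 'I_(size s).*2 => i.+1) by move=> i j [] /val_inj.
  rewrite cardE -(size_map (fun i : 'I_(size s).*2 => i.+1)) -/(size [:: p.1; p.2]).
  apply: uniq_leq_size; first by rewrite map_inj_uniq ?enum_uniq.
  by move=> k /mapP[i]; rewrite mem_enum !inE => ip ->.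
have cardA : #|A| <= size s.
  by rewrite cardsE; apply: leq_trans (card_size _) _; rewrite size_map.
have [sum_le sumE] := leqif_sum (fun B BA => leqif_eq (A_le2 B BA)).
rewrite sum_nat_const muln2 in sum_le sumE.
have [cov_le covE] := leq_card_cover A; rewrite covA cardsT card_ord in cov_le covE.
have leA : #|A|.*2 <= (size s).*2 by rewrite leq_double.
have triA : trivIset A by rewrite -covE eqn_leq cov_le (leq_trans sum_le leA).
have A2 : [forall B in A, #|B| == 2].
  by rewrite -sumE eqn_leq sum_le (leq_trans leA cov_le).
rewrite /matching A2 andbT /partition covA eqxx triA /=.
by apply/negP=> /(forall_inP A2); rewrite cards0.
Qed.

Lemma P1_matching : matching (tagged P1).
Proof. by apply: arcs_of_matching. Qed.

Lemma P3_matching : matching (tagged P3).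
Proof. by apply: arcs_of_matching. Qed.

Local Open Scope ring_scope.

Section PowerSeries.
Variable R : comUnitRingType.

(* Formal power series as coefficient sequences, compared with =1 *)
Definition fps := nat -> R.
Implicit Types f g : fps.

Definition fps_of_poly (p : {poly R}) : fps := fun n => p`_n.

Definition fps_mul f g : fps := fun n => \sum_(i < n.+1) f i * g (n - i)%N.

(* The first n + 1 coefficients of 1 / f, where f 0 is a unit *)
Fixpoint fps_inv_coefs f n : seq R :=
  if n is m.+1 then
    let s := fps_inv_coefs f m in
    rcons s (- (f 0%N)^-1 * \sum_(i < m.+1) f i.+1 * s`_(m - i))
  else [:: (f 0%N)^-1].

Definition fps_inv f : fps := fun n => (fps_inv_coefs f n)`_n.

Definition fps_div f g : fps := fps_mul f (fps_inv g).

Lemma size_fps_inv_coefs f n : size (fps_inv_coefs f n) = n.+1.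
Proof. by elim: n => //= n IHn; rewrite size_rcons IHn. Qed.

Lemma nth_fps_inv_coefs f n i : (i <= n)%N -> (fps_inv_coefs f n)`_i = fps_inv f i.
Proof.
elim: n => [|n IHn]; first by rewrite leqn0 => /eqP->.
rewrite leq_eqVlt => /predU1P[-> // | lt_in].
by rewrite /= nth_rcons size_fps_inv_coefs lt_in IHn.
Qed.

Lemma fps_mulfV f :
  f 0%N \is a GRing.unit -> fps_mul f (fps_inv f) =1 fps_of_poly 1.
Proof.
move=> f0U [|n]; rewrite /fps_mul /fps_of_poly coef1.
  by rewrite big_ord1 /fps_inv /= divrr.
rewrite big_ord_recl subn0 {1}/fps_inv /= nth_rcons size_fps_inv_coefs ltnn eqxx.
rewrite mulNr mulrN mulVKr // addrC; apply/eqP; rewrite subr_eq0; apply/eqP.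
apply: eq_bigr => i _; rewrite subSS nth_fps_inv_coefs ?leq_subr //.
Qed.

End PowerSeries.

(* Main.v *)
Require Import Defs.
From mathcomp Require Import all_boot all_order all_algebra.
From mathcomp Require Import zify ring.

(** A Stoimenow matching avoids [P1] exactly when it has no two nested arcs
    at all ([stoimenow_avoids_P1]). Indeed, suppose that an arc [b, b'] contains
    an arc [c, c']. Walking to the right from the opener b, the closers of the
    openers met so far increase, for lack of a nesting at neighbouring openers;
    as the closer of c is smaller than b', a closer must be met before c, and it
    ends an arc that starts before b. Symmetrically some arc starts between c'
    and b' and ends after b'. These four arcs form [P1].

    A nonnesting matching is determined by the number a_i of closers to the
    left of its i-th opener (counted from 0): its i-th opener is at the
    position i + a_i, and it is joined to the i-th closer. The sequences that
    arise are the weakly increasing ones with a_i <= i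
    ([ballot_matchingP], [ballot_matching_nonnesting], [nonnesting_ballot],
    [ballot_matching_inj]).

    In a nonnesting matching an occurrence of [P3] can be moved so that its
    first and last arcs are the first and last arcs of the matching. Therefore
    [P3] is avoided iff there are no crossing arcs i < j that both start after
    the first closer and end before the last opener, that is, iff a_j > i
    whenever a_i > 0 and i < j < m, where m = a_{n-1}
    ([ballot_avoids_P3]).

    Let k be the number of zeros of a. If m <= k + 1, this condition is void, and
    such a sequence is k zeros followed by a weakly increasing sequence in
    [1, k+1] of length n - k. The latter lists the heights of the horizontal
    steps of a lattice path with n - k horizontal steps and k raises, so it is
    encoded by a word of n letters. Only the condition a_k <= k has to be
    imposed, and it excludes the n words made of k < n raises followed by
    horizontal steps. This gives 2^n - n sequences ([word_seq_ballot],
    [ballot_word_seq]). If m >= k + 2, then avoidance forces a_i = i for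
    k < i < m, and after that only the values m - 1 and m are possible.
    Such a sequence is given by the four numbers a_k - 1 < k < m - 1 < s < n,
    where s is the first index of the value m, so there are C(n, 4) of them
    ([quad_ballot], [ballot_quad_seq]).

    The coefficients 2^n - n + C(n, 4) satisfy the linear recurrence with
    characteristic polynomial (1 - x)^5 (1 - 2x), and multiplication by
    this denominator leaves the numerator ([count_recurrence]). *)

Set Implicit Arguments.
Unset Strict Implicit.
Unset Printing Implicit Defensive.

Import GRing.Theory.

(* The name is also that of an operation on cyclic sequences. *)
Local Notation arc := Defs.arc.

(** * Matchings as fixpoint-free involutions *)

Section Mate.
Variable n : nat.
Implicit Type M : arcset n.

Definition mate M (x : 'I_n.*2) : 'I_n.*2 :=
  odflt x [pick y | (y != x) && ([set x; y] \in M)].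

Lemma mateP M x : matching M -> mate M x != x /\ [set x; mate M x] \in M.
Proof.
case/andP=> /and3P[/eqP covM _ _] /forall_inP card2; rewrite /mate.
case: pickP => [y /andP[] // | no_mate].
have /bigcupP[B BM xB] : x \in cover M by rewrite covM inE.
have /cards2P[y [z [neq_yz defB]]] := card2 B BM.
rewrite {}defB in xB BM; case/set2P: xB => eq_x; rewrite -{}eq_x in neq_yz BM.
  by have := no_mate z; rewrite eq_sym neq_yz BM.
by have := no_mate y; rewrite neq_yz setUC BM.
Qed.

Lemma mateE M x y : matching M -> x != y -> [set x; y] \in M -> mate M x = y.
Proof.
move=> mM neq_xy xyM; have [_ xmM] := mateP x mM.
case/andP: mM => /and3P[_ /trivIsetP trivM _] _.
have eq_sets : [set x; y] = [set x; mate M x].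
  apply/eqP; apply: contraT => /(trivM _ _ xyM xmM).
  by rewrite disjoint_subset => /subsetP/(_ x); rewrite !inE eqxx => /(_ isT).
have /set2P[yx | //] : y \in [set x; mate M x] by rewrite -eq_sets set22.
by rewrite yx eqxx in neq_xy.
Qed.

Lemma mateK M : matching M -> involutive (mate M).
Proof. by move=> mM x; have [? ?] := mateP x mM; apply: mateE; rewrite // setUC. Qed.

Lemma mate_neq M x : matching M -> mate M x != x.
Proof. by move=> mM; case: (mateP x mM). Qed.

Lemma arcE M x y : matching M -> arc M x y = (x < y) && (mate M x == y).
Proof.
move=> mM; rewrite /arc; case: ltnP => //= lt_xy; apply/idP/eqP => [xyM | <-].
  by apply: mateE => //; apply: contraTneq lt_xy => ->; rewrite ltnn.
by have [] := mateP x mM.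
Qed.

Lemma matching_eq_mate M M' :
  matching M -> matching M' -> mate M =1 mate M' -> M = M'.
Proof.
have sub N N' : matching N -> matching N' -> mate N =1 mate N' -> N \subset N'.
  move=> mN mN' eq_m; apply/subsetP => B BN.
  have /cards2P[x [y [neq_xy defB]]] : #|B| == 2.
    by case/andP: mN => _ /forall_inP; apply.
  rewrite defB in BN *; rewrite -(mateE mN neq_xy BN) eq_m.
  by have [] := mateP x mN'.
by move=> mM mM' eq_m; apply/eqP; rewrite eqEsubset !sub.
Qed.

Definition nonnesting M :=
  [forall a, forall b, forall c, forall d,
    ~~ [&& arc M a d, arc M b c, a < b & c < d]].

Lemma nonnestingP M :
  reflect (forall a b c d, arc M a d -> arc M b c -> a < b -> d <= c)
          (nonnesting M).
Proof.
apply: (iffP idP) => [nnM a b c d ad bc lt_ab | nnM].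
  move/forallP/(_ a)/forallP/(_ b)/forallP/(_ c)/forallP/(_ d): nnM.
  by rewrite ad bc lt_ab /= -leqNgt.
apply/forallP => a; apply/forallP => b; apply/forallP => c; apply/forallP => d.
by apply/and4P => -[ad bc lt_ab]; rewrite ltnNge (nnM a b c d).
Qed.

End Mate.

(** * Stoimenow matchings without P1 are nonnesting *)

(** The neighbour of b on its right is an opener whose arc also contains [c, g c],
    or a closer. In the first case the arc moves closer to c, which
    gives the induction; in the second case the closer ends the desired arc,
    which does not start at b because the arc of b ends after c. *)
Lemma nested_crossing N (g : 'I_N -> 'I_N) (b c : 'I_N) :
    involutive g ->
    (forall i i' : 'I_N, i' = i.+1 :> nat -> i < g i -> i' < g i' -> g i < g i') ->
    (forall i, g i != i) ->
    b < c -> c < g c -> g c < g b ->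
  exists q : 'I_N, [/\ q < b, b < g q & g q < c].
Proof.
move=> gK no_left g_neq.
have [m] := ubnP (c - b); elim: m b => // m IHm b lt_cbm lt_bc lt_cgc lt_gcgb.
have lt_b1 : b.+1 < N by apply: leq_ltn_trans lt_bc (ltn_ord c).
pose b' : 'I_N := Ordinal lt_b1.
have b'E : b' = b.+1 :> nat by [].
have gneq x : g x <> x :> nat by move=> e; case/eqP: (g_neq x); apply: val_inj.
have [op | cl | e] := ltngtP b' (g b'); last by case: (gneq b').
  have lt_g := no_left b b' b'E ltac:(lia) op.
  have neq_b'c : b' <> c by move=> e; rewrite -e in lt_gcgb; lia.
  have {}neq_b'c : b' <> c :> nat by move=> e; apply: neq_b'c; apply: val_inj.
  have [||//|| q [lt_qb' lt_b'q lt_qc]] := IHm b'; rewrite ?b'E; try lia.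
  have neq_qb : q <> b by move=> e; rewrite e in lt_qc; lia.
  have {}neq_qb : q <> b :> nat by move=> e; apply: neq_qb; apply: val_inj.
  by exists q; split; lia.
have neq_gb'b : g b' <> b by move=> e; rewrite -e gK in lt_gcgb; lia.
have {}neq_gb'b : g b' <> b :> nat by move=> e; apply: neq_gb'b; apply: val_inj.
have neq_b'c : b' <> c by move=> e; rewrite e in cl; lia.
have {}neq_b'c : b' <> c :> nat by move=> e; apply: neq_b'c; apply: val_inj.
by exists (g b'); rewrite gK; split; lia.
Qed.

(** The mirror image of [nested_crossing]: reversing the order of the points
    exchanges openers and closers. *)
Lemma nested_crossing_rev N (g : 'I_N -> 'I_N) (b c : 'I_N) :
    involutive g ->
    (forall j j' : 'I_N, j' = j.+1 :> nat -> g j < j -> g j' < j' -> g j < g j') ->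
    (forall i, g i != i) ->
    b < c -> c < g c -> g c < g b ->
  exists q : 'I_N, [/\ g c < q, q < g b & g b < g q].
Proof.
move=> gK no_right g_neq lt_bc lt_cgc lt_gcgb.
pose h x := rev_ord (g (rev_ord x)).
have hK : involutive h by move=> x; rewrite /h rev_ordK gK rev_ordK.
have hN x : h (rev_ord x) = rev_ord (g x) by rewrite /h rev_ordK.
have rev_lt (x y : 'I_N) : (rev_ord x < rev_ord y) = (y < x).
  by rewrite /=; have := ltn_ord x; have := ltn_ord y; lia.
have [||||| q] := nested_crossing hK (b := rev_ord (g b)) (c := rev_ord (g c)).
- move=> i i' i'E; rewrite /h /= !rev_lt => lt_i lt_i'.
  have := ltn_ord i'; have := ltn_ord (g (rev_ord i)).
  by move=> *; apply: no_right => /=; lia.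
- by move=> i; rewrite /h (can2_eq rev_ordK rev_ordK) g_neq.
- by rewrite rev_lt.
- by rewrite hN gK rev_lt.
- by rewrite !hN !gK rev_lt.
rewrite -[q]rev_ordK hN !rev_lt => -[lt1 lt2 lt3].
by exists (g (rev_ord q)); rewrite gK.
Qed.

(** Since the patterns are matchings, the arcs that realize an occurrence and
    their number are recovered from the order embedding of the endpoints. *)
Lemma containsP n s (M : arcset n) :
    perm_eq (flatten [seq [:: p.1; p.2] | p <- s]) (iota 1 (size s).*2) ->
  reflect
    (exists2 f : 'I_(size s).*2 -> 'I_n.*2, {homo f : i j / (i < j)%N} &
       forall i j : 'I_(size s).*2, (i.+1, j.+1) \in s -> [set f i; f j] \in M)
    (contains M (arcs_of s)).
Proof.
move=> s_perm.
have imE (f : 'I_(size s).*2 -> 'I_n.*2) (i j : 'I_(size s).*2) :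
    f @: [set k : 'I_(size s).*2 | (k.+1 == i.+1) || (k.+1 == j.+1)] =
    [set f i; f j].
  have ->: [set k : 'I_(size s).*2 | (k.+1 == i.+1) || (k.+1 == j.+1)] =
           [set i; j].
    by apply/setP=> k; rewrite !inE !eqSS.
  by rewrite imsetU !imset_set1.
apply: (iffP existsP) => [[S /existsP[f]] | [f f_homo fM]].
  case/and5P=> SM _ /forallP f_homo _ /eqP defS.
  exists f => [i j | i j ij_s]; first by have /forallP/(_ j)/implyP := f_homo i.
  apply: (subsetP SM); rewrite -defS -imE; apply: imset_f.
  by rewrite inE; apply/mapP; exists (i.+1, j.+1).
have f_inj : injective f.
  move=> i j eq_f; apply: val_inj; case: (ltngtP i j) => // /f_homo;
    by rewrite eq_f ltnn.
have f'E : [ffun i => f i] =1 f by move=> i; rewrite ffunE.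
exists [set f @: (B : {set _}) | B in arcs_of s].
apply/existsP; exists [ffun i => f i].
have [/andP[] partP /forall_inP card2] := arcs_of_matching s_perm.
have cardP : #|arcs_of s| = size s.
  have := card_uniform_partition (fun B BP => eqP (card2 B BP)) partP.
  by rewrite cardsT card_ord muln2 => /double_inj.
apply/and5P; split.
- apply/subsetP => _ /imsetP[B + ->]; rewrite inE => /mapP[[p1 p2] ps ->].
  have p_s : {subset [:: p1; p2] <= iota 1 (size s).*2}.
    move=> k kp; rewrite -(perm_mem s_perm); apply/flatten_mapP.
    by exists (p1, p2).
  have /p_s := mem_head p1 [:: p2]; rewrite mem_iota.
  have /p_s := mem_last p1 [:: p2]; rewrite mem_iota /=.
  case: p2 p1 ps {p_s} => [|j] [|i] //= ps lt_j lt_i.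
  rewrite add1n ltnS in lt_j; rewrite add1n ltnS in lt_i.
  by have := imE f (Ordinal lt_i) (Ordinal lt_j); rewrite /= => ->; apply: fM.
- by rewrite card_imset ?cardP //; apply: imset_inj.
- by apply/forallP=> i; apply/forallP=> j; rewrite !f'E; apply/implyP/f_homo.
- rewrite (eq_imset _ f'E) cover_imset; apply/eqP/setP => y; apply/imsetP/bigcupP.
    case=> x _ ->; have: x \in cover (arcs_of s).
      by case/and3P: partP => /eqP-> _ _; rewrite inE.
    by case/bigcupP=> B BP xB; exists B => //; apply: imset_f.
  by case=> B BP /imsetP[x xB ->]; exists x.
- by apply/eqP/eq_in_imset => B _; apply: eq_imset.
Qed.

Lemma contains_P1 n (M : arcset n) :
  reflect (exists a b a' c c' d b' d' : 'I_n.*2,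
    [/\ sorted (relpre val ltn) [:: a; b; a'; c; c'; d; b'; d'],
        [set a; a'] \in M, [set b; b'] \in M, [set c; c'] \in M
      & [set d; d'] \in M])
    (contains M (tagged P1)).
Proof.
pose o k (lt_k8 : k < 8) : 'I_4.*2 := Ordinal lt_k8.
apply: (iffP (containsP _ _)) => // [[f f_homo fM] |]; last first.
  case=> [a [b [a' [c [c' [d [b' [d' [s_x aM bM cM dM]]]]]]]]].
  exists (fun i => nth a [:: a; b; a'; c; c'; d; b'; d'] i) => [i j lt_ij | i j].
    apply: (sorted_ltn_nth _ a s_x) lt_ij; last 2 first.
    - exact: (ltn_ord i).
    - exact: (ltn_ord j).
    by move=> y x z; apply: ltn_trans.
  by rewrite !inE => /or4P[] /eqP[-> ->].
exists (f (@o 0 isT)), (f (@o 1 isT)), (f (@o 2 isT)), (f (@o 3 isT)).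
exists (f (@o 4 isT)), (f (@o 5 isT)), (f (@o 6 isT)), (f (@o 7 isT)).
by split; [rewrite /= !f_homo | apply: fM..].
Qed.

Lemma contains_P3 n (M : arcset n) :
  reflect (exists a a' b c b' c' d d' : 'I_n.*2,
    [/\ sorted (relpre val ltn) [:: a; a'; b; c; b'; c'; d; d'],
        [set a; a'] \in M, [set b; b'] \in M, [set c; c'] \in M
      & [set d; d'] \in M])
    (contains M (tagged P3)).
Proof.
pose o k (lt_k8 : k < 8) : 'I_4.*2 := Ordinal lt_k8.
apply: (iffP (containsP _ _)) => // [[f f_homo fM] |]; last first.
  case=> [a [a' [b [c [b' [c' [d [d' [s_x aM bM cM dM]]]]]]]]].
  exists (fun i => nth a [:: a; a'; b; c; b'; c'; d; d'] i) => [i j lt_ij | i j].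
    apply: (sorted_ltn_nth _ a s_x) lt_ij; last 2 first.
    - exact: (ltn_ord i).
    - exact: (ltn_ord j).
    by move=> y x z; apply: ltn_trans.
  by rewrite !inE => /or4P[] /eqP[-> ->].
exists (f (@o 0 isT)), (f (@o 1 isT)), (f (@o 2 isT)), (f (@o 3 isT)).
exists (f (@o 4 isT)), (f (@o 5 isT)), (f (@o 6 isT)), (f (@o 7 isT)).
by split; [rewrite /= !f_homo | apply: fM..].
Qed.

(** Conversely to the argument with [nested_crossing], the forbidden
    configurations of Stoimenow matchings are nestings, and the second arc of
    [P1] contains the third. *)
Lemma stoimenow_avoids_P1 n (M : arcset n) :
  stoimenow M && avoids M P1 = matching M && nonnesting M.
Proof.
rewrite /stoimenow /avoids; case mM: (matching M) => //=.
apply/idP/nonnestingP => [/andP[/andP[no1 no2] noP1] a b c d | nnM].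
  rewrite !arcE // => /andP[lt_ad /eqP eq_d] /andP[lt_bc /eqP eq_c] lt_ab.
  rewrite leqNgt; apply: contra noP1 => lt_cd; subst c d.
  have [||||| q [lt_qa lt_aq lt_qb]] := nested_crossing (b := a) (c := b) (mateK mM).
  - move=> i i' i'E lt_i lt_i'; rewrite ltnNge leq_eqVlt; apply: contra no1.
    case/orP=> [/eqP/val_inj/(can_inj (mateK mM)) e | lt_m].
      by rewrite e in i'E; lia.
    apply/existsP; exists i; apply/existsP; exists i'.
    apply/existsP; exists (mate M i'); apply/existsP; exists (mate M i).
    rewrite !arcE // !eqxx lt_i lt_i' lt_m.
    by apply/and5P; split=> //; apply/eqP.
  - by move=> i; apply: mate_neq.
  - by [].
  - by [].
  - by [].
  have [||||| r [lt_br lt_ra lt_ar]] :=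
      nested_crossing_rev (b := a) (c := b) (mateK mM).
  - move=> j j' j'E lt_j lt_j'; rewrite ltnNge leq_eqVlt; apply: contra no2.
    case/orP=> [/eqP/val_inj/(can_inj (mateK mM)) e | lt_m].
      by rewrite e in j'E; lia.
    apply/existsP; exists j; apply/existsP; exists j'.
    apply/existsP; exists (mate M j'); apply/existsP; exists (mate M j).
    rewrite !arcE // !mateK // !eqxx lt_j lt_j' lt_m.
    by apply/and5P; split=> //; apply/eqP.
  - by move=> i; apply: mate_neq.
  - by [].
  - by [].
  - by [].
  have arcM x : [set x; mate M x] \in M by case: (mateP x mM).
  apply/contains_P1.
  exists q, a, (mate M q), b, (mate M b), r, (mate M a), (mate M r).
  split; try exact: arcM.
  by rewrite /= lt_qa lt_aq lt_qb lt_bc lt_br lt_ra lt_ar.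
apply/andP; split; last first.
  apply/contains_P1=> -[a [b [a' [c [c' [d [b' [d' [/= s_x _ bM cM _]]]]]]]]].
  have := nnM b c c' b'; rewrite /arc bM cM.
  by rewrite !andbT; lia.
apply/andP; split.
  apply/negP=> /existsP[i /existsP[i' /existsP[k /existsP[l]]]].
  case/and5P=> /eqP i'E il i'k _ lt2.
  have := nnM _ _ _ _ il i'k; rewrite [nat_of_ord i']i'E.
  by rewrite ltnSn leqNgt lt2 => /(_ isT).
apply/negP=> /existsP[j /existsP[j' /existsP[k /existsP[l]]]].
case/and5P=> /eqP j'E kj' lj lt1 _.
by have := nnM _ _ _ _ kj' lj lt1; rewrite [nat_of_ord j']j'E ltnn.
Qed.

(** * Nonnesting matchings as ballot sequences *)

(** Term i counts the closers to the left of the i-th opener. *)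
Definition ballot (n : nat) (a : seq nat) :=
  [&& size a == n, sorted leq a & all (fun i => nth 0 a i <= i) (iota 0 n)].

Definition opener_pos (a : seq nat) (i : nat) := i + nth 0 a i.

(** The i-th closer is preceded by i closers and by the openers that have at
    most i closers to their left. *)
Definition closer_pos (a : seq nat) (i : nat) := i + count (leq^~ i) a.

(** The terms that are at most j form a prefix, whose length is their number. *)
Lemma nth_leq_count (a : seq nat) i j :
  sorted leq a -> i < size a -> (nth 0 a i <= j) = (i < count (leq^~ j) a).
Proof.
elim: a i => // x a IHa i /= x_a lt_ia.
have all_x : all (leq x) a.
  by move: x_a; rewrite path_sortedE; [case/andP | apply: leq_trans].
case: i lt_ia => [|i] lt_ia /=; last first.
  rewrite IHa ?(path_sorted x_a) //.
  case: (leqP x j) => [_ | lt_jx]; first by rewrite add1n ltnS.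
  suff ->: count (leq^~ j) a = 0 by rewrite !ltn0.
  apply/eqP; rewrite -leqn0 leqNgt -has_count; apply/hasPn=> y /(allP all_x) le_xy.
  by rewrite -ltnNge (leq_trans lt_jx).
case: (leqP x j) => // lt_jx; rewrite add0n.
suff ->: count (leq^~ j) a = 0 by [].
apply/eqP; rewrite -leqn0 leqNgt -has_count; apply/hasPn=> y /(allP all_x) le_xy.
by rewrite -ltnNge (leq_trans lt_jx).
Qed.

Section Ballot.
Variables (n : nat) (a : seq nat).
Hypothesis a_ballot : ballot n a.

Lemma ballot_size : size a = n. Proof. by case/and3P: a_ballot => /eqP. Qed.

Lemma ballot_sorted : sorted leq a. Proof. by case/and3P: a_ballot. Qed.

Lemma ballot_nth i : i < n -> nth 0 a i <= i.
Proof. by case/and3P: a_ballot => _ _ /allP H lt_in; apply: H; rewrite mem_iota. Qed.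

Lemma ballot_mono i j : i <= j -> j < n -> nth 0 a i <= nth 0 a j.
Proof.
move=> le_ij lt_jn; apply: (sorted_leq_nth leq_trans leqnn 0 ballot_sorted) => //;
  by rewrite inE ballot_size // (leq_ltn_trans le_ij).
Qed.

Lemma opener_pos_homo i j : i < j -> j < n -> opener_pos a i < opener_pos a j.
Proof.
by move=> lt_ij lt_jn; rewrite /opener_pos -addSn leq_add // ballot_mono // ltnW.
Qed.

Lemma closer_pos_homo i j : i < j -> closer_pos a i < closer_pos a j.
Proof.
move=> lt_ij; rewrite /closer_pos -addSn leq_add //; apply: sub_count => x /= le_xi.
by rewrite (leq_trans le_xi) // ltnW.
Qed.

Lemma opener_lt_closer i j :
  i < n -> (opener_pos a i < closer_pos a j) = (nth 0 a i <= j).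
Proof.
move=> lt_in; have := nth_leq_count j ballot_sorted.
rewrite ballot_size => /(_ _ lt_in).
by rewrite /opener_pos /closer_pos; case: leqP; lia.
Qed.

Lemma opener_neq_closer i j : i < n -> opener_pos a i <> closer_pos a j.
Proof.
move=> lt_in; have := nth_leq_count j ballot_sorted.
rewrite ballot_size => /(_ _ lt_in).
by rewrite /opener_pos /closer_pos; case: leqP; lia.
Qed.

Lemma opener_pos_bound i : i < n -> opener_pos a i < n.*2.
Proof. by move=> lt_in; have := ballot_nth lt_in; rewrite /opener_pos; lia. Qed.

Lemma closer_pos_bound i : i < n -> closer_pos a i < n.*2.
Proof.
move=> lt_in; have := count_size (leq^~ i) a; rewrite ballot_size /closer_pos; lia.
Qed.

End Ballot.

Definition ballot_matching n (a : seq nat) : arcset n :=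
  [set [set x : 'I_n.*2 | (x == opener_pos a i :> nat)
                       || (x == closer_pos a i :> nat)] | i : 'I_n].

Section BallotMatching.
Variables (n : nat) (a : seq nat).
Hypothesis a_ballot : ballot n a.

Let op (i : 'I_n) : 'I_n.*2 := Ordinal (opener_pos_bound a_ballot (ltn_ord i)).
Let cl (i : 'I_n) : 'I_n.*2 := Ordinal (closer_pos_bound a_ballot (ltn_ord i)).

Let op_inj : injective op.
Proof.
move=> i j /(congr1 val) /= e; apply: val_inj => /=.
case: (ltngtP i j) => // lt_ij.
  by have := opener_pos_homo a_ballot lt_ij (ltn_ord j); rewrite e ltnn.
by have := opener_pos_homo a_ballot lt_ij (ltn_ord i); rewrite e ltnn.
Qed.

Let cl_inj : injective cl.
Proof.
move=> i j /(congr1 val) /= e; apply: val_inj => /=.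
by case: (ltngtP i j) => // /(closer_pos_homo a); rewrite e ltnn.
Qed.

Let op_neq_cl i j : op i != cl j.
Proof. by apply/eqP=> /(congr1 val)/(opener_neq_closer a_ballot (ltn_ord i)). Qed.

Let ballot_matchingE : ballot_matching n a = [set [set op i; cl i] | i : 'I_n].
Proof. by apply: eq_imset => i; apply/setP=> x; rewrite !inE -!val_eqE. Qed.

Lemma ballot_matchingP : matching (ballot_matching n a).
Proof.
rewrite ballot_matchingE; apply/andP; split; last first.
  by apply/forall_inP=> _ /imsetP[i _ ->]; rewrite cards2 op_neq_cl.
pose pos (u : 'I_n + 'I_n) := match u with inl i => op i | inr i => cl i end.
have pos_inj : injective pos.
  move=> [i|i] [j|j] /= e; first by rewrite (op_inj e).
  - by case/eqP: (op_neq_cl i j).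
  - by case/eqP: (op_neq_cl j i).
  by rewrite (cl_inj e).
apply/and3P; split.
- apply/eqP/setP=> x; rewrite inE cover_imset; apply/bigcupP.
  have /codomP[[i|i] ->] : x \in codom pos.
    by apply: inj_card_onto pos_inj _ x; rewrite card_sum !card_ord addnn.
  + by exists i; rewrite // set21.
  + by exists i; rewrite // set22.
- apply/trivIsetP=> _ _ /imsetP[i _ ->] /imsetP[j _ ->]; apply: contraR.
  case/pred0Pn=> x /= /andP[/set2P[]-> /set2P[] e].
  + by rewrite (op_inj e).
  + by case/eqP: (op_neq_cl i j).
  + by case/eqP: (op_neq_cl j i).
  + by rewrite (cl_inj e).
- by apply/imsetP=> -[i _] /setP/(_ (op i)); rewrite set21 inE.
Qed.

Lemma ballot_arcP (x y : 'I_n.*2) :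
  reflect
    (exists2 i, i < n & x = opener_pos a i :> nat /\ y = closer_pos a i :> nat)
    (arc (ballot_matching n a) x y).
Proof.
have lt_op_cl i : op i < cl i.
  by rewrite /= (opener_lt_closer a_ballot) // (ballot_nth a_ballot).
rewrite /arc ballot_matchingE; apply: (iffP andP).
  case=> lt_xy /imsetP[i _ e].
  exists (nat_of_ord i); first exact: ltn_ord.
  have /set2P[] : x \in [set op i; cl i] by rewrite -e set21.
    have /set2P[] : y \in [set op i; cl i] by rewrite -e set22.
      by move=> yE xE; rewrite yE xE ltnn in lt_xy.
    by move=> yE xE; rewrite xE yE.
  have /set2P[] : y \in [set op i; cl i] by rewrite -e set22.
    by move=> yE xE; have := lt_op_cl i; rewrite xE yE ltnNge ltnW in lt_xy *.
  by move=> yE xE; rewrite yE xE ltnn in lt_xy.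
case=> i lt_in [xE yE].
have ->: x = op (Ordinal lt_in) by apply: val_inj.
have ->: y = cl (Ordinal lt_in) by apply: val_inj.
by split; [apply: lt_op_cl | apply: imset_f].
Qed.

Lemma ballot_matching_nonnesting : nonnesting (ballot_matching n a).
Proof.
apply/nonnestingP=> x y y' x'.
move=> /ballot_arcP[i lt_in [-> ->]] /ballot_arcP[j lt_jn [-> ->]].
case: (ltngtP i j) => [/(closer_pos_homo a)/ltnW // | lt_ji | -> //].
by rewrite ltnNge (ltnW (opener_pos_homo a_ballot lt_ji lt_in)).
Qed.

End BallotMatching.

Definition openers n (M : arcset n) := [set x | [exists y, arc M x y]].

Lemma sorted_val_enum N (A : {set 'I_N}) : sorted ltn (map val (enum A)).
Proof.
rewrite sorted_map; rewrite {1}/enum_mem -enumT.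
apply: sorted_filter => [x y z|]; first exact: ltn_trans.
by rewrite -sorted_map val_enum_ord iota_ltn_sorted.
Qed.

Lemma openersE n (M : arcset n) x : matching M -> (x \in openers M) = (x < mate M x).
Proof.
move=> mM; rewrite inE; apply/existsP/idP => [[y] | lt_x]; last first.
  by exists (mate M x); rewrite arcE // lt_x eqxx.
by rewrite arcE // => /andP[lt_xy /eqP->].
Qed.

Lemma openers_mate n (M : arcset n) x :
  matching M -> (mate M x \in openers M) = (x \notin openers M).
Proof.
move=> mM; rewrite !openersE // mateK // -leqNgt ltn_neqAle.
by rewrite (inj_eq val_inj) mate_neq.
Qed.

(** Without nesting, taking mates is increasing on the openers, so it maps the
    sorted list of openers to the sorted list of closers. *)
Lemma eq_nonnesting n (M M' : arcset n) :
    matching M -> matching M' -> nonnesting M -> nonnesting M' ->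
  openers M = openers M' -> M = M'.
Proof.
move=> mM mM' nnM nnM' eq_op.
have map_mate N : matching N -> nonnesting N ->
    [seq mate N x | x <- enum (openers N)] = enum (~: openers N).
  move=> mN /nonnestingP nnN; apply: (@irr_sorted_eq _ (relpre val ltn)).
  - by move=> y x z; apply: ltn_trans.
  - by move=> x; apply: ltnn.
  - have Hs : sorted (relpre val ltn) (enum (openers N)).
      by rewrite -sorted_map sorted_val_enum.
    apply: homo_sorted_in Hs; last by apply/allP=> x; rewrite mem_enum; apply.
    move=> x y xO yO /= lt_xy; rewrite ltnNge leq_eqVlt.
    apply/negP=> /orP[/eqP/val_inj/(can_inj (mateK mN)) e | lt_m].
      by rewrite e ltnn in lt_xy.
    rewrite openersE // in xO; rewrite openersE // in yO.
    have := nnN x y (mate N y) (mate N x).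
    by rewrite !arcE // xO yO !eqxx => /(_ isT isT lt_xy); rewrite leqNgt lt_m.
  - by rewrite -sorted_map sorted_val_enum.
  move=> x; rewrite mem_enum inE -openers_mate //; apply/mapP/idP => [[y + ->] | mxO].
    by rewrite mem_enum mateK.
  by exists (mate N x); rewrite ?mem_enum ?mateK.
have eq_mO x : x \in openers M -> mate M x = mate M' x.
  have /eq_in_map eq_m : [seq mate M y | y <- enum (openers M)]
                       = [seq mate M' y | y <- enum (openers M)].
    by rewrite map_mate // eq_op map_mate.
  by rewrite -mem_enum => /eq_m.
apply: matching_eq_mate => // x; have [/eq_mO // | xnO] := boolP (x \in openers M).
have mxO : mate M x \in openers M by rewrite openers_mate.
by rewrite -[x in RHS](mateK mM) (eq_mO _ mxO) mateK.
Qed.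

Lemma openers_ballot n a : ballot n a ->
  map val (enum (openers (ballot_matching n a))) = map (opener_pos a) (iota 0 n).
Proof.
move=> a_ballot; apply: (irr_sorted_eq ltn_trans ltnn).
- exact: sorted_val_enum.
- apply: (homo_sorted_in (P := [pred i | i < n]) (e := ltn));
    last exact: iota_ltn_sorted.
    by move=> i j _ lt_jn lt_ij; exact: (opener_pos_homo a_ballot lt_ij lt_jn).
  by apply/allP=> i; rewrite mem_iota.
move=> k; apply/mapP/mapP => [[x + ->] | [i + ->]].
  rewrite mem_enum inE => /existsP[y /(ballot_arcP a_ballot)[i lt_in [xE _]]].
  by exists i; rewrite ?mem_iota.
rewrite mem_iota => lt_in; have lt_o := opener_pos_bound a_ballot lt_in.
exists (Ordinal lt_o) => //; rewrite mem_enum inE; apply/existsP.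
exists (Ordinal (closer_pos_bound a_ballot lt_in)).
by apply/(ballot_arcP a_ballot); exists i.
Qed.

Lemma ballot_matching_inj n a b :
  ballot n a -> ballot n b -> ballot_matching n a = ballot_matching n b -> a = b.
Proof.
move=> aB bB eq_M; apply: (@eq_from_nth _ 0).
  by rewrite (ballot_size aB) (ballot_size bB).
rewrite (ballot_size aB) => i lt_in; apply: (@addnI i); rewrite -!/(opener_pos _ i).
have := congr1 (fun s => nth 0 s i) (openers_ballot aB).
by rewrite eq_M openers_ballot // !(nth_map 0) ?size_iota // nth_iota // add0n.
Qed.

Lemma card_openers n (M : arcset n) : matching M -> #|openers M| = n.
Proof.
move=> mM; apply: double_inj; rewrite -[RHS]card_ord -(cardsC (openers M)) -addnn.
congr (_ + _); rewrite -(card_imset _ (can_inj (mateK mM))); congr #|pred_of_set _|.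
apply/setP=> x; rewrite inE -openers_mate //; apply/imsetP/idP => [[y yO ->] | mxO].
  by rewrite mateK.
by exists (mate M x); rewrite ?mateK.
Qed.

(** Every point to the left of the i-th opener is one of the first i openers or
    the mate of one of them. *)
Lemma nth_opener_le_double n (M : arcset n) i :
  matching M -> i < n -> nth 0 (map val (enum (openers M))) i <= i.*2.
Proof.
move=> mM lt_in; set s := enum _; set x := nth _ _ _.
have s_sorted : sorted ltn (map val s) by apply: sorted_val_enum.
have size_s : size s = n by rewrite -cardE card_openers.
have take_s y : y \in openers M -> y < x -> y \in take i s.
  move=> yO lt_yx; have ys : y \in s by rewrite mem_enum.
  rewrite in_take // ltnNge; apply/negP=> le_i.
  have lt_ind : index y s < size (map val s) by rewrite size_map index_mem.
  have := sorted_leq_nth leq_trans leqnn 0 (sub_sorted (@ltnW) s_sorted).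
  move/(_ i (index y s)); rewrite !inE lt_ind size_map size_s => /(_ lt_in isT le_i).
  by rewrite [nth _ _ (index _ _)](nth_map y) ?index_mem // nth_index // leqNgt lt_yx.
have -> : i.*2 = size (map val (take i s ++ map (mate M) (take i s))).
  by rewrite size_map size_cat size_map size_takel ?size_s ?addnn // ltnW.
rewrite -[x in x <= _](size_iota 0); apply: uniq_leq_size (iota_uniq _ _) _ => k.
rewrite mem_iota /= add0n => lt_kx.
have x_bound : x < n.*2.
  have [//|] := boolP (x \in map val s); last by rewrite mem_nth // size_map size_s.
  by case/mapP=> y _ ->; apply: ltn_ord.
apply/mapP; exists (Ordinal (ltn_trans lt_kx x_bound)) => //; set y := Ordinal _.
rewrite mem_cat; have [yO | ynO] := boolP (y \in openers M); first by rewrite take_s.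
have myO : mate M y \in openers M by rewrite openers_mate.
apply/orP; right; rewrite -[y](mateK mM); apply/map_f/take_s => //.
by move: myO; rewrite openersE // mateK // => /ltn_trans; apply.
Qed.

(** The i-th opener o_i has i openers and hence o_i - i closers to its left. *)
Lemma nonnesting_ballot n (M : arcset n) :
  matching M -> nonnesting M -> exists2 a, ballot n a & M = ballot_matching n a.
Proof.
move=> mM nnM; pose o := map val (enum (openers M)).
have o_sorted : sorted ltn o by apply: sorted_val_enum.
have size_o : size o = n by rewrite size_map -cardE card_openers.
have lt_o i : i.+1 < n -> nth 0 o i < nth 0 o i.+1.
  by move=> lt_in; move/(sortedP 0): o_sorted; apply; rewrite size_o.
have le_o i : i < n -> i <= nth 0 o i.
  elim: i => // i IHi lt_in; apply: leq_ltn_trans (lt_o _ lt_in).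
  exact: IHi (ltnW lt_in).
have o_le i : i < n -> nth 0 o i <= i.*2 by apply: nth_opener_le_double.
pose a := mkseq (fun i => nth 0 o i - i) n.
have a_ballot : ballot n a.
  apply/and3P; split; first by rewrite size_mkseq.
    apply/(sortedP 0) => i; rewrite size_mkseq => lt_in.
    by rewrite !nth_mkseq ?(ltnW lt_in) //; have := lt_o i lt_in; lia.
  apply/allP=> i; rewrite mem_iota => lt_in; rewrite nth_mkseq //.
  by have := o_le i lt_in; lia.
exists a => //; apply: eq_nonnesting => //.
- exact: ballot_matchingP.
- exact: ballot_matching_nonnesting.
have eq_o : map val (enum (openers (ballot_matching n a))) = o.
  rewrite openers_ballot //.
  apply: (@eq_from_nth _ 0); rewrite size_map size_iota ?size_o //.
  move=> i lt_in; rewrite (nth_map 0) ?size_iota // nth_iota // add0n /opener_pos.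
  by rewrite nth_mkseq // subnKC // le_o.
apply/setP=> x; rewrite -[LHS]mem_enum -[RHS]mem_enum.
by rewrite -[LHS](mem_map val_inj) -[RHS](mem_map val_inj) eq_o.
Qed.

(** * Avoiding P3 *)

(** As [last 0 a] is less than the length of a ballot sequence, the indices that
    matter are below this length, so the default value of [nth] is harmless. The
    matching [P3] represents the poset with a least, a greatest and two
    incomparable elements, the diamond. *)
Definition diamond_free (a : seq nat) :=
  forall i j, 0 < nth 0 a i -> i < j < last 0 a -> i < nth 0 a j.

Lemma last_ballot n a : ballot n a -> last 0 a = nth 0 a n.-1.
Proof. by move=> a_ballot; rewrite -(ballot_size a_ballot) nth_last. Qed.

Lemma last_ballot_lt n a : ballot n a -> 0 < n -> last 0 a < n.
Proof.
move=> a_ballot n_gt0; rewrite (last_ballot a_ballot).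
apply: leq_ltn_trans (ballot_nth a_ballot _) _; lia.
Qed.

(** Opener i precedes closer j iff a_i <= j. If the terms i < j violate the
    condition, then the arcs number 0, i, j and n - 1 form [P3]. *)
Lemma ballot_avoids_P3 n a : ballot n a ->
  avoids (ballot_matching n a) P3 <-> diamond_free a.
Proof.
move=> a_ballot; have lt_oc := opener_lt_closer a_ballot.
have neq_oc := opener_neq_closer a_ballot.
split=> [noP3 i j a_i /andP[lt_ij lt_jl] | a_free].
  rewrite ltnNge; apply: contra noP3 => a_j.
  have n_gt0 : 0 < n by case: (n) a_ballot lt_jl => // /ballot_size/size0nil->.
  have lt_ln := last_ballot_lt a_ballot n_gt0.
  have lt_jn : j < n by lia.
  have lt_in : i < n by lia.
  have lt_n1 : n.-1 < n by lia.
  pose x0 := Ordinal (opener_pos_bound a_ballot n_gt0).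
  have [op opE] : exists op : nat -> 'I_n.*2,
      forall k, k < n -> op k = opener_pos a k :> nat.
    exists (fun k => insubd x0 (opener_pos a k)).
    by move=> k lt_kn; rewrite val_insubd (opener_pos_bound a_ballot).
  have [cl clE] : exists cl : nat -> 'I_n.*2,
      forall k, k < n -> cl k = closer_pos a k :> nat.
    exists (fun k => insubd x0 (closer_pos a k)).
    by move=> k lt_kn; rewrite val_insubd (closer_pos_bound a_ballot).
  have oc_arc k : k < n -> [set op k; cl k] \in ballot_matching n a.
    move=> lt_kn; have /andP[] // : arc (ballot_matching n a) (op k) (cl k).
    by apply/(ballot_arcP a_ballot); exists k; rewrite ?opE ?clE.
  have co k l : l < n -> k < nth 0 a l -> closer_pos a k < opener_pos a l.
    move=> lt_ln'; rewrite ltnNge -lt_oc // => ?.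
    by have := neq_oc _ k lt_ln'; lia.
  apply/contains_P3.
  exists (op 0), (cl 0), (op i), (op j), (cl i), (cl j), (op n.-1), (cl n.-1).
  split; try exact: oc_arc.
  rewrite /= !opE // !clE // !lt_oc // !co //; last 1 first.
  - by rewrite -(last_ballot a_ballot).
  rewrite (opener_pos_homo a_ballot) // a_j closer_pos_homo //.
  by rewrite !(ballot_nth a_ballot).
apply/contains_P3=> -[x [x' [y [z [y' [z' [t [t' [/= sorted_x xM yM zM tM]]]]]]]]].
have arcM (u v : 'I_n.*2) : u < v -> [set u; v] \in ballot_matching n a ->
    exists2 k, k < n & u = opener_pos a k :> nat /\ v = closer_pos a k :> nat.
  by move=> lt_uv uvM; apply/(ballot_arcP a_ballot); rewrite /arc lt_uv.
have [i0 lt_i0 [xE x'E]] := arcM x x' ltac:(lia) xM.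
have [i lt_in [yE y'E]] := arcM y y' ltac:(lia) yM.
have [j lt_jn [zE z'E]] := arcM z z' ltac:(lia) zM.
have [l lt_ln [tE t'E]] := arcM t t' ltac:(lia) tM.
rewrite xE x'E yE y'E zE z'E tE t'E in sorted_x.
have a_i : i0 < nth 0 a i by rewrite ltnNge -lt_oc //; lia.
have a_j : nth 0 a j <= i by rewrite -lt_oc //; lia.
have a_l : j < nth 0 a l by rewrite ltnNge -lt_oc //; lia.
have lt_ij : i < j.
  rewrite ltnNge leq_eqVlt; apply/negP=> /orP[/eqP e | lt_ji].
    by rewrite e in sorted_x; lia.
  by have := opener_pos_homo a_ballot lt_ji lt_in; lia.
have le_al : nth 0 a l <= last 0 a.
  by rewrite (last_ballot a_ballot) (ballot_mono a_ballot) //; lia.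
have := a_free i j (leq_ltn_trans (leq0n _) a_i); rewrite lt_ij (leq_trans a_l le_al).
by move=> /(_ isT); rewrite ltnNge a_j.
Qed.

(** * Sequences whose last term is at most one more than the number of zeros *)

(** The heights of the horizontal steps ([true]) of a lattice path that starts at
    height [c]; [false] is a step that raises the height by one. *)
Fixpoint staircase (c : nat) (w : seq bool) : seq nat :=
  match w with
  | [::] => [::]
  | b :: w' => if b then c :: staircase c w' else staircase c.+1 w'
  end.

Lemma size_staircase c w : size (staircase c w) = count id w.
Proof. by elim: w c => //= -[] w IHw c /=; rewrite IHw. Qed.

Lemma staircase_ge c w : all (leq c) (staircase c w).
Proof.
elim: w c => //= -[] w IHw c /=; first by rewrite leqnn IHw.
by apply: sub_all (IHw c.+1) => x /ltnW.
Qed.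

Lemma staircase_le c w : all (leq^~ (c + count negb w)) (staircase c w).
Proof.
elim: w c => //= -[] w IHw c /=; first by rewrite leq_addr add0n IHw.
by rewrite add1n addnS -addSn IHw.
Qed.

Lemma staircase_sorted c w : sorted leq (staircase c w).
Proof.
elim: w c => //= -[] w IHw c //=; rewrite path_sortedE; last exact: leq_trans.
by rewrite staircase_ge IHw.
Qed.

Lemma staircase_inj c w w' :
  size w = size w' -> staircase c w = staircase c w' -> w = w'.
Proof.
have no_head d v v' : d :: staircase d v = staircase d.+1 v' -> False.
  by move=> e; have := staircase_ge d.+1 v'; rewrite -e /= ltnn.
elim: w w' c => [|b w IHw] [|b' w'] c //= [sz].
case: b b' => -[] => [[e]|e|e|e].
- by rewrite (IHw _ _ sz e).
- by case: (no_head _ _ _ e).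
- by case: (no_head _ _ _ (esym e)).
by rewrite (IHw _ _ sz e).
Qed.

(** After its last horizontal step the path is raised up to the height c + k,
    which fixes the length of the word. *)
Lemma staircase_onto c k s :
    sorted leq s -> all (leq c) s -> all (leq^~ (c + k)) s ->
  exists w, [/\ size w = size s + k, count negb w = k & staircase c w = s].
Proof.
have [m] := ubnP (size s + k).
elim: m s c k => // m IHm [|x s] c k lt_m s_sorted s_ge s_le.
  exists (nseq k false); rewrite size_nseq count_nseq mul1n; split=> //.
  by elim: (k) (c) => //= j IHj d; rewrite IHj.
have x_s : all (leq x) s.
  by move: s_sorted => /=; rewrite path_sortedE; [case/andP | apply: leq_trans].
move: s_ge s_le lt_m => /= /andP[le_cx s_ge] /andP[le_xck s_le] lt_m.
have [eq_xc | neq_xc] := eqVneq x c.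
  have [|||| w [szw cw sw]] := IHm s c k => //; first exact: path_sorted s_sorted.
  by exists (true :: w); rewrite /= sw szw cw eq_xc.
have lt_cx : c < x by rewrite ltn_neqAle eq_sym neq_xc.
case: k le_xck s_le lt_m => [|k] le_xck s_le lt_m; first by lia.
have [|||| w [szw cw sw]] := IHm (x :: s) c.+1 k => //.
- by rewrite /= ; lia.
- by rewrite /= lt_cx; apply: sub_all x_s => y; apply: leq_trans.
- by rewrite /= addSn -addnS le_xck.
by exists (false :: w); rewrite /= sw szw cw; split=> //=; lia.
Qed.

(** The paths whose horizontal steps are all at the greatest height. *)
Definition raises_first n k := nseq k false ++ nseq (n - k) true.

Lemma size_raises_first n k : k <= n -> size (raises_first n k) = n.
Proof. by move=> le_kn; rewrite size_cat !size_nseq subnKC. Qed.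

Lemma count_raises_first n k : count negb (raises_first n k) = k.
Proof. by rewrite count_cat !count_nseq mul1n addn0. Qed.

Lemma staircase_raises_first c n k : staircase c (raises_first n k) = nseq (n - k) (c + k).
Proof.
have up d m : staircase d (nseq m true) = nseq m d by elim: m => //= m ->.
rewrite /raises_first; elim: k c (n - k) => [|k IHk] c m /=; first by rewrite addn0 up.
by rewrite IHk addnS.
Qed.

(** The number of raises serves twice: it is the number of zeros, and it bounds
    the other terms by one more than this number. *)
Definition word_seq (w : seq bool) := nseq (count negb w) 0 ++ staircase 1 w.

Lemma size_word_seq w : size (word_seq w) = size w.
Proof. by rewrite size_cat size_nseq size_staircase addnC count_predC. Qed.

Lemma count_word_seq w : count (leq^~ 0) (word_seq w) = count negb w.
Proof.
rewrite count_cat count_nseq mul1n; apply/eqP.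
rewrite -{2}[count negb w]addn0 eqn_add2l.
rewrite -leqn0 leqNgt -has_count; apply/hasPn=> x /(allP (staircase_ge 1 w)).
by rewrite -ltnNge.
Qed.

Lemma word_seq_inj w w' : size w = size w' -> word_seq w = word_seq w' -> w = w'.
Proof.
move=> sz e; have eq_c := congr1 (count (leq^~ 0)) e; rewrite !count_word_seq in eq_c.
move/eqP: e; rewrite /word_seq eq_c eqseq_cat // => /andP[_ /eqP].
exact: staircase_inj.
Qed.

Lemma last_word_seq w : last 0 (word_seq w) <= (count negb w).+1.
Proof.
have := mem_last 0 (word_seq w); rewrite inE mem_cat => /or3P[/eqP-> // | | xs].
  by rewrite mem_nseq => /andP[_ /eqP->].
by rewrite -add1n; apply: allP (staircase_le 1 w) _ xs.
Qed.

(** All nonzero terms are at most k + 1 and stand at places i >= k, where k is the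
    number of zeros. So a_i <= i can only fail at i = k with a_k = k + 1, and then
    all later terms are k + 1 too. For [diamond_free], two distinct places from k on
    cannot both be below the last term. *)
Lemma word_seq_ballot n w :
    size w = n -> (forall k, k < n -> w <> raises_first n k) ->
  ballot n (word_seq w) /\ diamond_free (word_seq w).
Proof.
move=> szw w_good; set k := count negb w.
have le_kn : k <= n by rewrite -szw count_size.
have nth_word i :
    nth 0 (word_seq w) i = if i < k then 0 else nth 0 (staircase 1 w) (i - k).
  by rewrite nth_cat size_nseq nth_nseq if_same.
have s_le i : nth 0 (staircase 1 w) i <= k.+1.
  have [lt_i | le_i] := ltnP i (size (staircase 1 w));
    last by rewrite nth_default.
  by rewrite -add1n; apply: allP (staircase_le 1 w) _ (mem_nth _ lt_i).
have s_head : k < n -> nth 0 (staircase 1 w) 0 <= k.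
  move=> lt_kn; rewrite leqNgt; apply/negP=> gt_k; apply: (w_good k lt_kn).
  apply: (@staircase_inj 1); first by rewrite szw size_raises_first.
  rewrite staircase_raises_first.
  have sz_s : size (staircase 1 w) = n - k.
    by rewrite size_staircase -szw -(count_predC id w) addnK.
  apply: (@eq_from_nth _ 0); rewrite ?size_nseq // => i lt_i.
  rewrite nth_nseq -sz_s lt_i.
  apply/eqP; rewrite eqn_leq s_le; apply: leq_trans gt_k _.
  apply: (sorted_leq_nth leq_trans leqnn 0 (staircase_sorted 1 w)) => //.
  by rewrite inE; apply: leq_ltn_trans lt_i.
split.
  apply/and3P; split; first by rewrite size_word_seq szw.
    rewrite /word_seq; elim: (count negb w) => [|j IHj] /=.
      exact: staircase_sorted.
    by rewrite path_sortedE; [rewrite IHj andbT; apply/allP | apply: leq_trans].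
  apply/allP=> i; rewrite mem_iota add0n /= => lt_in; rewrite nth_word.
  case: ltngtP => // [lt_ki | eq_ik]; first exact: leq_trans (s_le _) lt_ki.
  by rewrite eq_ik subnn s_head // -eq_ik.
move=> i j; rewrite nth_word; case: (ltnP i k) => // le_ki _ /andP[lt_ij].
by move/leq_trans/(_ (last_word_seq w)); rewrite -/k; lia.
Qed.

(** The words that [word_seq_ballot] excludes would give the term k + 1 at
    place k. *)
Lemma ballot_word_seq n a :
    ballot n a -> diamond_free a -> last 0 a <= (count (leq^~ 0) a).+1 ->
  exists w, [/\ size w = n, forall k, k < n -> w <> raises_first n k & word_seq w = a].
Proof.
move=> a_ballot a_free; set k := count _ a => le_l.
have size_a := ballot_size a_ballot.
have nth_0 i : i < n -> (nth 0 a i <= 0) = (i < k).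
  by rewrite -size_a; apply: nth_leq_count (ballot_sorted a_ballot).
have le_kn : k <= n by rewrite -size_a count_size.
have take_a : take k a = nseq k 0.
  apply: (@eq_from_nth _ 0); rewrite size_takel ?size_nseq ?size_a // => i lt_ik.
  rewrite nth_take // nth_nseq lt_ik; apply/eqP; rewrite -leqn0 nth_0 //.
  exact: leq_trans lt_ik le_kn.
have [||| w [szw cw sw]] := @staircase_onto 1 k (drop k a).
- exact: drop_sorted (ballot_sorted a_ballot).
- apply/(all_nthP 0) => i; rewrite size_drop size_a nth_drop => lt_i.
  by rewrite ltnNge nth_0 -?leqNgt ?leq_addr //; lia.
- apply/(all_nthP 0) => i; rewrite size_drop size_a nth_drop add1n => lt_i.
  apply: leq_trans le_l; rewrite (last_ballot a_ballot).
  by apply: (ballot_mono a_ballot); lia.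
have word_a : word_seq w = a by rewrite /word_seq sw cw -take_a cat_take_drop.
have size_w : size w = n by rewrite szw size_drop size_a subnK.
exists w; split=> // j lt_jn w_du.
have eq_kj : k = j by rewrite -cw w_du count_raises_first.
have := ballot_nth a_ballot lt_jn; rewrite -word_a /word_seq cw eq_kj w_du.
rewrite nth_cat size_nseq ltnn subnn staircase_raises_first nth_nseq.
by rewrite subn_gt0 lt_jn add1n ltnn.
Qed.

(** * Sequences whose last term exceeds the number of zeros by at least two *)

(** Here [q] is the number of zeros, [p.+1] the first nonzero term, [r.+1] the last
    term, and [s] the first place where it occurs; the shifts by one turn all
    constraints into p < q < r < s < n. *)
Definition quad_seq (n p q r s : nat) :=
  mkseq (fun i => if i < q then 0 else if i == q then p.+1
                  else if i < s then minn i r else r.+1) n.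

Section Quad.
Variables n p q r s : nat.
Hypotheses (lt_pq : p < q) (lt_qr : q < r) (lt_rs : r < s) (lt_sn : s < n).

Lemma quad_ballot : ballot n (quad_seq n p q r s).
Proof.
apply/and3P; split; first by rewrite size_mkseq.
  apply/(sortedP 0) => i; rewrite size_mkseq => lt_in.
  by rewrite !nth_mkseq //; repeat case: ifP => ?; lia.
apply/allP=> i; rewrite mem_iota => lt_in.
by rewrite nth_mkseq //; repeat case: ifP => ?; lia.
Qed.

Lemma last_quad : last 0 (quad_seq n p q r s) = r.+1.
Proof. by rewrite (last_ballot quad_ballot) nth_mkseq; repeat case: ifP => ?; lia. Qed.

Lemma quad_diamond_free : diamond_free (quad_seq n p q r s).
Proof.
move=> i j a_i; rewrite last_quad => /andP[lt_ij lt_jr].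
have lt_jn : j < n by lia.
have lt_in : i < n by lia.
by move: a_i; rewrite !nth_mkseq //; repeat case: ifP => ?; lia.
Qed.

Lemma count_quad : count (leq^~ 0) (quad_seq n p q r s) = q.
Proof.
pose a := quad_seq n p q r s.
have nth_0 i : i < n -> (nth 0 a i <= 0) = (i < count (leq^~ 0) a).
  move=> lt_in; apply: nth_leq_count (ballot_sorted quad_ballot) _.
  by rewrite size_mkseq.
have lt_qn : q < n by lia.
have := nth_0 q lt_qn; have lt_q1n : q.-1 < n by lia.
have := nth_0 q.-1 lt_q1n; rewrite /a !nth_mkseq //; repeat case: ifP => ?; lia.
Qed.

End Quad.

Lemma quad_seq_inj n p q r s p' q' r' s' :
    p < q -> q < r -> r < s -> s < n -> p' < q' -> q' < r' -> r' < s' -> s' < n ->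
  quad_seq n p q r s = quad_seq n p' q' r' s' -> [/\ p = p', q = q', r = r' & s = s'].
Proof.
move=> lt_pq lt_qr lt_rs lt_sn lt_pq' lt_qr' lt_rs' lt_sn' e.
have eq_q : q = q' by rewrite -(count_quad lt_pq lt_qr lt_rs lt_sn) e count_quad.
have eq_r : r = r'.
  by apply: succn_inj; rewrite -(last_quad lt_pq lt_qr lt_rs lt_sn) e last_quad.
have eq_nth i :
    i < n -> nth 0 (quad_seq n p q r s) i = nth 0 (quad_seq n p' q' r' s') i.
  by rewrite e.
have := eq_nth q ltac:(lia); have := eq_nth s lt_sn; have := eq_nth s' lt_sn'.
have lt_qn : q < n by lia.
by rewrite !nth_mkseq // -eq_q -eq_r; repeat case: ifP => ?; split; lia.
Qed.

(** With k the number of zeros and m the last term, applying [diamond_free] to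
    neighbouring places i - 1 and i with k < i < m gives a_i > i - 1, hence
    a_i = i. From place m on, the terms lie between a_{m-1} = m - 1 and m. *)
Lemma ballot_quad_seq n a :
    ballot n a -> diamond_free a -> (count (leq^~ 0) a).+1 < last 0 a ->
  exists p q r s, [/\ p < q, q < r, r < s, s < n & quad_seq n p q r s = a].
Proof.
move=> a_ballot a_free; set q := count _ a => lt_ql.
have size_a := ballot_size a_ballot.
have nth_le j i : i < n -> (nth 0 a i <= j) = (i < count (leq^~ j) a).
  by rewrite -size_a; apply: nth_leq_count (ballot_sorted a_ballot).
have n_gt0 : 0 < n by case: (n) size_a lt_ql => // /size0nil->.
have lt_ln := last_ballot_lt a_ballot n_gt0.
have lt_qn : q < n by lia.
have a_q_gt0 : 0 < nth 0 a q by rewrite ltnNge nth_le // ltnn.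
have a_q_le := ballot_nth a_ballot lt_qn.
have [r lE] : exists r, last 0 a = r.+1 by exists (last 0 a).-1; lia.
set s := count (leq^~ r) a.
have mono := ballot_mono a_ballot.
have a_last : nth 0 a n.-1 = r.+1 by rewrite -(last_ballot a_ballot).
have a_id i : q < i -> i <= r -> nth 0 a i = i.
  move=> lt_qi le_ir; have lt_in : i < n by lia.
  have a_i1 : 0 < nth 0 a i.-1 by apply: leq_trans a_q_gt0 (mono _ _ _ _); lia.
  have := a_free _ i a_i1; have := ballot_nth a_ballot lt_in; rewrite lE => le_ai.
  by move=> /(_ ltac:(lia)); lia.
have lt_rn : r < n by lia.
exists (nth 0 a q).-1, q, r, s; split; try lia.
- by rewrite -nth_le // a_id //; lia.
- have := nth_le r n.-1; rewrite a_last -/s; lia.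
apply: (@eq_from_nth _ 0); rewrite size_mkseq ?size_a // => i lt_in.
rewrite nth_mkseq //.
case: ltnP => [lt_iq | le_qi].
  by apply/esym/eqP; rewrite -leqn0 nth_le.
case: eqVneq => [-> | neq_iq]; first lia.
have lt_qi : q < i by lia.
have := nth_le r i lt_in; rewrite -/s => <-.
case: leqP => [le_air | lt_rai].
  have [le_ir | lt_ri] := leqP i r; first by rewrite a_id //; lia.
  have := mono r i (ltnW lt_ri) lt_in; rewrite a_id //; lia.
have := mono i n.-1; rewrite a_last; lia.
Qed.

(** * The number of matchings *)

Lemma stoimenow_avoidingP n (M : arcset n) :
  reflect (exists a, [/\ ballot n a, diamond_free a & M = ballot_matching n a])
          (M \in stoimenow_avoiding n [:: P1; P3]).
Proof.
have all_two (p : pred pattern) : all p [:: P1; P3] = p P1 && p P3 by rewrite /= andbT.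
rewrite inE all_two andbA stoimenow_avoids_P1 -andbA.
apply: (iffP and3P) => [[mM nnM noP3] | [a [aB aF ->]]].
  have [a aB defM] := nonnesting_ballot mM nnM.
  by exists a; split=> //; apply/(ballot_avoids_P3 aB); rewrite -defM.
split; first exact: ballot_matchingP.
  exact: ballot_matching_nonnesting.
exact/(ballot_avoids_P3 aB).
Qed.

Definition good_words n : {set n.-tuple bool} :=
  [set w | [forall k : 'I_n, tval w != raises_first n k]].

Lemma card_good_words n : #|good_words n| = 2 ^ n - n.
Proof.
pose du (k : 'I_n) : n.-tuple bool :=
  Tuple (introT eqP (size_raises_first (ltnW (ltn_ord k)))).
have du_inj : injective du.
  move=> i j /(congr1 (fun w : n.-tuple bool => count negb w)).
  by rewrite !count_raises_first => /val_inj.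
rewrite cardsCs card_tuple card_bool; congr (_ - _).
rewrite -[RHS]card_ord -cardsT -(card_imset _ du_inj); congr #|pred_of_set _|.
apply/setP=> w; rewrite !inE negb_forall; apply/existsP/imsetP => [[k] | [k _ ->]].
  by rewrite negbK => /eqP wE; exists k => //; apply: val_inj.
by exists k; rewrite negbK.
Qed.

Definition quads n : {set 4.-tuple 'I_n} :=
  [set t : 4.-tuple 'I_n | sorted ltn [seq val i | i <- t]].

Definition quad_tuple_seq n (t : 4.-tuple 'I_n) :=
  let u := nth 0 [seq val i | i <- t] in quad_seq n (u 0) (u 1) (u 2) (u 3).

Lemma quadsP n (t : 4.-tuple 'I_n) : t \in quads n ->
  exists p q r s, [/\ [seq val i | i <- t] = [:: p; q; r; s],
    p < q, q < r, r < s & s < n].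
Proof.
rewrite inE; case: t => -[|p [|q [|r [|s []]]]] //= _ /and4P[lt_pq lt_qr lt_rs _].
by exists p, q, r, s; split.
Qed.

(** The two families of sequences are disjoint, since they compare the last term
    with the number of zeros in opposite ways. *)
Lemma card_stoimenow_avoiding n :
  #|stoimenow_avoiding n [:: P1; P3]| = 2 ^ n - n + 'C(n, 4).
Proof.
pose F (w : n.-tuple bool) := ballot_matching n (word_seq w).
pose G (t : 4.-tuple 'I_n) := ballot_matching n (quad_tuple_seq t).
have good_ballot (w : n.-tuple bool) : w \in good_words n ->
    ballot n (word_seq w) /\ diamond_free (word_seq w).
  rewrite inE => /forallP w_good; apply: word_seq_ballot; first exact: size_tuple.
  by move=> k lt_kn; apply/eqP; apply: (w_good (Ordinal lt_kn)).
have quads_ballot t : t \in quads n -> ballot n (quad_tuple_seq t).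
  case/quadsP=> p [q [r [s [tE ? ? ? ?]]]].
  by rewrite /quad_tuple_seq tE; apply: quad_ballot.
have F_inj : {in good_words n &, injective F}.
  move=> w w' /good_ballot[wB _] /good_ballot[wB' _] /(ballot_matching_inj wB wB') e.
  by apply: val_inj; apply: word_seq_inj e; rewrite !size_tuple.
have G_inj : {in quads n &, injective G}.
  move=> t t' tQ tQ'.
  move/(ballot_matching_inj (quads_ballot t tQ) (quads_ballot t' tQ')).
  have [p [q [r [s [tE pq qr rs sn]]]]] := quadsP tQ.
  have [p' [q' [r' [s' [tE' pq' qr' rs' sn']]]]] := quadsP tQ'.
  rewrite /quad_tuple_seq tE tE' /= => e.
  apply/val_inj/(inj_map val_inj); rewrite tE tE'.
  by have [-> -> -> ->] := quad_seq_inj pq qr rs sn pq' qr' rs' sn' e.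
have defS : stoimenow_avoiding n [:: P1; P3] = F @: good_words n :|: G @: quads n.
  apply/setP=> M; rewrite in_setU; apply/stoimenow_avoidingP/orP.
    case=> a [aB aF ->]; have [le_l | gt_l] := leqP (last 0 a) (count (leq^~ 0) a).+1.
      have [w [sz_w w_good wE]] := ballot_word_seq aB aF le_l.
      left; apply/imsetP; exists (Tuple (introT eqP sz_w)); last by rewrite /F /= wE.
      by rewrite inE; apply/forallP=> k; apply/eqP/w_good.
    have [p [q [r [s [lt_pq lt_qr lt_rs lt_sn qE]]]]] := ballot_quad_seq aB aF gt_l.
    have lt_rn := ltn_trans lt_rs lt_sn; have lt_qn := ltn_trans lt_qr lt_rn.
    have lt_pn := ltn_trans lt_pq lt_qn.
    pose t := [tuple Ordinal lt_pn; Ordinal lt_qn; Ordinal lt_rn; Ordinal lt_sn].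
    right; apply/imsetP; exists t; last by rewrite /G -qE.
    by rewrite inE /= lt_pq lt_qr lt_rs.
  case=> /imsetP[].
    by move=> w /good_ballot[wB wF] ->; exists (word_seq w).
  move=> t tQ ->; exists (quad_tuple_seq t); split=> //; first exact: quads_ballot.
  have [p [q [r [s [tE ? ? ? ?]]]]] := quadsP tQ.
  by rewrite /quad_tuple_seq tE; apply: quad_diamond_free.
have disjFG : F @: good_words n :&: G @: quads n = set0.
  apply/setP=> M; rewrite in_setI in_set0.
  apply/andP=> -[/imsetP[w wW ->] /imsetP[t tQ]].
  have [wB _] := good_ballot w wW.
  move=> /(ballot_matching_inj wB (quads_ballot t tQ)) e.
  have := last_word_seq w; rewrite -count_word_seq {}e.
  have [p [q [r [s [tE ? ? ? ?]]]]] := quadsP tQ.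
  by rewrite /quad_tuple_seq tE [last _ _]last_quad // [count _ _]count_quad //=; lia.
rewrite defS cardsU disjFG cards0 subn0 !card_in_imset // card_good_words.
by rewrite card_ltn_sorted_tuples.
Qed.

(** * The generating function *)

Local Open Scope ring_scope.

Section FormalPowerSeries.
Variable R : comUnitRingType.
Implicit Types f g h : fps R.

(** Associativity and commutativity of the product of power series are inherited
    from polynomials, because a coefficient only depends on truncations. *)
Lemma fps_mul_trunc f g n k : (k <= n)%N ->
  fps_mul f g k = ((\poly_(i < n.+1) f i) * (\poly_(i < n.+1) g i))`_k.
Proof.
move=> le_kn; rewrite coefM; apply: eq_bigr => i _; rewrite !coef_poly !ltnS.
by rewrite (leq_trans (leq_subr _ _) le_kn) (leq_trans _ le_kn) // -ltnS.
Qed.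

Lemma fps_mulC f g : fps_mul f g =1 fps_mul g f.
Proof. by move=> n; rewrite !(fps_mul_trunc _ _ (leqnn n)) mulrC. Qed.

Lemma eq_fps_mul f f' g g' : f =1 f' -> g =1 g' -> fps_mul f g =1 fps_mul f' g'.
Proof. by move=> eq_f eq_g n; apply: eq_bigr => i _; rewrite eq_f eq_g. Qed.

Lemma fps_mulA f g h : fps_mul f (fps_mul g h) =1 fps_mul (fps_mul f g) h.
Proof.
move=> n; pose p u : {poly R} := \poly_(i < n.+1) u i.
transitivity ((p f * (p g * p h))`_n); last rewrite mulrA.
  rewrite coefM; apply: eq_bigr => i _; rewrite coef_poly ltn_ord.
  by rewrite (@fps_mul_trunc _ _ n) // leq_subr.
rewrite [in LHS]coefM; apply: eq_bigr => i _.
rewrite [(p h)`_ _]coef_poly ltnS leq_subr.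
by rewrite (@fps_mul_trunc _ _ n) // -ltnS.
Qed.

Lemma fps_mul1 f : fps_mul f (fps_of_poly 1) =1 f.
Proof.
move=> n; rewrite fps_mulC /fps_mul big_ord_recl big1 => [|i _].
  by rewrite /fps_of_poly coef1 mul1r addr0 subn0.
by rewrite /fps_of_poly coef1 mul0r.
Qed.

Lemma fps_div_unique f g h :
  g 0%N \is a GRing.unit -> fps_mul g h =1 f -> h =1 fps_div f g.
Proof.
move=> gU eq_f n; rewrite /fps_div -(eq_fps_mul eq_f (frefl _)).
rewrite (eq_fps_mul (fps_mulC g h) (frefl _)).
by rewrite -fps_mulA (eq_fps_mul (frefl h) (fps_mulfV gU)) fps_mul1.
Qed.

End FormalPowerSeries.

Lemma denominatorE :
  (1 - 'X) ^+ 5 * (1 - 2 *: 'X) =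
  Poly [:: 1; -7; 20; -30; 25; -11; 2] :> {poly int}.
Proof. by rewrite /= !cons_poly_def -!mul_polyC; ring. Qed.

Lemma numeratorE :
  1 - 6 *: 'X + 15 *: 'X^2 - 19 *: 'X^3 + 13 *: 'X^4 - 5 *: 'X^5 =
  Poly [:: 1; -6; 15; -19; 13; -5] :> {poly int}.
Proof. by rewrite /= !cons_poly_def -!mul_polyC; ring. Qed.

(** The factor 24 clears the denominators of the binomial coefficient as a
    polynomial in [m]; this polynomial also vanishes for m < 4. *)
Lemma bin4E m : ('C(m, 4))%:Z * 24 = m%:Z * (m%:Z - 1) * (m%:Z - 2) * (m%:Z - 3).
Proof.
rewrite -[24]/(Posz 4`!) -PoszM bin_ffact.
case: m => [|[|[|m]]]; rewrite ?mul0r ?mulr0 //.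
rewrite !ffactnS ffactn0 !PoszM /=; lia.
Qed.

(** From degree 6 on, this says that the coefficients satisfy the recurrence
    given by the denominator, an identity that is linear in 2^m and polynomial in m
    once the binomial coefficients are expanded by [bin4E]. *)
Lemma count_recurrence :
  fps_mul (fps_of_poly ((1 - 'X) ^+ 5 * (1 - 2 *: 'X) : {poly int}))
    (fun n => (2 ^ n - n + 'C(n, 4))%:Z) =1
  fps_of_poly (1 - 6 *: 'X + 15 *: 'X^2 - 19 *: 'X^3 + 13 *: 'X^4 - 5 *: 'X^5).
Proof.
pose c n : int := 2 ^+ n - n%:Z + 'C(n, 4)%:Z.
have cE n : (2 ^ n - n + 'C(n, 4))%:Z = c n.
  by rewrite PoszD -subzn; [rewrite -[Posz (2 ^ n)]natz natrX | apply/ltnW/ltn_expl].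
rewrite denominatorE numeratorE => n; rewrite /fps_mul /fps_of_poly coef_Poly.
under eq_bigr do rewrite cE coef_Poly.
have [lt_n6 | ] := ltnP n 6.
  (* the coefficients of the numerator, by computation *)
  move: n lt_n6; do 6![case=> [_|]; first by rewrite !big_ord_recl big_ord0 /c].
  by [].
case: n => [|[|[|[|[|[|m]]]]]] // _; rewrite 7!big_ord_recl big1 /=; last first.
  by move=> i _; rewrite nth_nil mul0r.
rewrite nth_nil /bump /= !add1n !subSS !subn0 /c !exprS.
have := bin4E m; have := bin4E m.+1; have := bin4E m.+2; have := bin4E m.+3.
have := bin4E m.+4; have := bin4E m.+4.+1; have := bin4E m.+4.+2.
move: (2 ^+ m) => t.
(* in terms of m and t = 2^m, the goal is linear over the seven identities *)
have S k : k.+1%:Z = k%:Z + 1 by rewrite -addn1 PoszD.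
rewrite !S.
do 7![move: ('C(_, _)%:Z) => ?].
move: m%:Z => x.
by move=> *; lia.
Qed.

Theorem theorem3p2 :
  (fun n : nat => (#|stoimenow_avoiding n [:: P1; P3]|)%:Z) =1
  fps_div
    (fps_of_poly (1 - 6 *: 'X + 15 *: 'X^2 - 19 *: 'X^3 + 13 *: 'X^4 - 5 *: 'X^5
                  : {poly int}))
    (fps_of_poly ((1 - 'X) ^+ 5 * (1 - 2 *: 'X) : {poly int})).
Proof.
move=> n; rewrite card_stoimenow_avoiding.
apply: fps_div_unique count_recurrence n.
by rewrite denominatorE /fps_of_poly coef_Poly.
Qed.
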